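(* Let $G$ be a set and $\alpha_G:G\to\mathbf N$ a function. The category $\mathcal{WO}_e$ determined by $G$ and $\alpha_G$ is a preorder; i.e., for any two objects $f,g$ of $\mathcal{WO}_e$ there is at most one arrow from $f$ to $g$.
   Context: **Words and nominal arities.** An $\mathbf N^+$-word is a finite (possibly empty) sequence of positive integers; $e$ is the empty word and $ab$ is the concatenation of $a$ and $b$. A nominal arity is a set of $\mathbf N^+$-words that contains no two distinct words of the form $a$ and $ab$. A word $a$ is a prefix of a nominal arity $X$ if $a$ is an initial segment (not necessarily proper) of every member of $X$; $P_X$ is the set of prefixes of $X$ (every word is a prefix of $\emptyset$). Put $a\cdot X=\{ab\mid b\in X\}$. If $a\in P_X\cap Y$, put $Y\triangleleft_a X=(Y\setminus\{a\})\cup X$, which is a nominal arity. For $n\ge 0$, $\bar n=\{1,\dots,n\}$ (one-letter words), $\bar 0=\emptyset$. **Objects.** The objects of $\mathcal{WO}_e$ are the terms of $\mathcal O_e$ (formal expressions, not identified by any equations), defined inductively together with a nominal arity $s(f)$ for each term $f$: (0) each $x\in G$ is a term, with $s(x)=\overline{\alpha_G(x)}$ if $\alpha_G(x)\ne 1$ and $s(x)=\{e\}$ if $\alpha_G(x)=1$; (1) $\mathbf I$ is a term, $s(\mathbf I)=\{e\}$; (2) if $f,g$ are terms and $a\in s(g)$, then $g\triangleleft_a f$ is a term, with $s(g\triangleleft_a f)=s(g)\triangleleft_a a\cdot s(f)$. **Arrow terms.** The basic arrow terms are, for all terms and words such that the following conditions hold: - $\mathbf 1_f:f\to f$; - $\beta_{h,(b,g),(a,f)}:(h\triangleleft_b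 g)\triangleleft_{ba}f\to h\triangleleft_b(g\triangleleft_a f)$ and $\beta^{-1}_{h,(b,g),(a,f)}:h\triangleleft_b(g\triangleleft_a f)\to(h\triangleleft_b g)\triangleleft_{ba}f$, where $b\in s(h)$, $a\in s(g)$; - $\theta_{h,(b,g),(a,f)}:(h\triangleleft_b g)\triangleleft_a f\to(h\triangleleft_a f)\triangleleft_b g$, where $a,b\in s(h)$, $a\neq b$; - $\mu_{f,a}:f\triangleleft_a\mathbf I\to f$ and $\mu^{-1}_{f,a}:f\to f\triangleleft_a\mathbf I$, where $a\in s(f)$; - $\lambda_f:\mathbf I\triangleleft_e f\to f$ and $\lambda^{-1}_f:f\to\mathbf I\triangleleft_e f$. Arrow terms are closed under composition ($v\circ u:f\to h$ for $u:f\to g$, $v:g\to h$) and under insertions: if $u:f\to f'$ and $v:g\to g'$ are arrow terms and $g\triangleleft_a f$, $g'\triangleleft_a f'$ are terms, then $v\triangleleft_a u:g\triangleleft_a f\to g'\triangleleft_a f'$ is an arrow term. **Equations.** The arrows of $\mathcal{WO}_e$ are the equivalence classes of arrow terms under the smallest equivalence relation $=$ (between arrow terms of the same type) that is a congruence for $\circ$ and all $\triangleleft_a$, satisfies the category axioms ($u\circ\mathbf 1_f=u=\mathbf 1_g\circ u$ for $u:f\to g$; associativity of $\circ$), and contains all instances of the following in which both sides are well-formed arrow terms: - $\mathbf 1_g\triangleleft_a\mathbf 1_f=\mathbf 1_{g\triangleleft_a f}$; $(v_2\circ v_1)\triangleleft_a(u_2\circ u_1)=(v_2\triangleleft_a u_2)\circ(v_1\triangleleft_a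 u_1)$; - for $u:f_1\to f_2$, $v:g_1\to g_2$, $w:h_1\to h_2$: $\beta_{h_2,(b,g_2),(a,f_2)}\circ((w\triangleleft_b v)\triangleleft_{ba}u)=(w\triangleleft_b(v\triangleleft_a u))\circ\beta_{h_1,(b,g_1),(a,f_1)}$ and $\theta_{h_2,(b,g_2),(a,f_2)}\circ((w\triangleleft_b v)\triangleleft_a u)=((w\triangleleft_a u)\triangleleft_b v)\circ\theta_{h_1,(b,g_1),(a,f_1)}$; - $\beta$ and $\beta^{-1}$ (with the same indices) are mutually inverse; $\theta_{h,(a,f),(b,g)}\circ\theta_{h,(b,g),(a,f)}=\mathbf 1_{(h\triangleleft_b g)\triangleleft_a f}$; - $(\mathbf 1_j\triangleleft_c\beta_{h,(b,g),(a,f)})\circ\beta_{j,(c,h\triangleleft_b g),(ba,f)}\circ(\beta_{j,(c,h),(b,g)}\triangleleft_{cba}\mathbf 1_f)=\beta_{j,(c,h),(b,g\triangleleft_a f)}\circ\beta_{j\triangleleft_c h,(cb,g),(a,f)}$; - $\theta_{j\triangleleft_a f,(c,h),(b,g)}\circ(\theta_{j,(c,h),(a,f)}\triangleleft_b\mathbf 1_g)\circ\theta_{j\triangleleft_c h,(b,g),(a,f)}=(\theta_{j,(b,g),(a,f)}\triangleleft_c\mathbf 1_h)\circ\theta_{j\triangleleft_b g,(c,h),(a,f)}\circ(\theta_{j,(c,h),(b,g)}\triangleleft_a\mathbf 1_f)$; - $(\mathbf 1_j\triangleleft_c\theta_{h,(b,g),(a,f)})\circ\beta_{j,(c,h\triangleleft_b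 g),(a,f)}\circ(\beta_{j,(c,h),(b,g)}\triangleleft_{ca}\mathbf 1_f)=\beta_{j,(c,h\triangleleft_a f),(b,g)}\circ(\beta_{j,(c,h),(a,f)}\triangleleft_{cb}\mathbf 1_g)\circ\theta_{j\triangleleft_c h,(cb,g),(ca,f)}$; - $\theta_{j,(c,h\triangleleft_b g),(a,f)}\circ(\beta_{j,(c,h),(b,g)}\triangleleft_a\mathbf 1_f)=\beta_{j\triangleleft_a f,(c,h),(b,g)}\circ(\theta_{j,(c,h),(a,f)}\triangleleft_{cb}\mathbf 1_g)\circ\theta_{j\triangleleft_c h,(cb,g),(a,f)}$; - for $u:f_1\to f_2$: $\mu_{f_2,a}\circ(u\triangleleft_a\mathbf 1_{\mathbf I})=u\circ\mu_{f_1,a}$ and $\lambda_{f_2}\circ(\mathbf 1_{\mathbf I}\triangleleft_e u)=u\circ\lambda_{f_1}$; $\mu,\mu^{-1}$ and $\lambda,\lambda^{-1}$ (with the same indices) are mutually inverse; - $\beta_{h,(b,\mathbf I),(e,f)}=(\mathbf 1_h\triangleleft_b\lambda^{-1}_f)\circ(\mu_{h,b}\triangleleft_b\mathbf 1_f)$; $\theta_{h,(b,\mathbf I),(a,f)}=\mu^{-1}_{h\triangleleft_a f,b}\circ(\mu_{h,b}\triangleleft_a\mathbf 1_f)$. *)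

(* Defs.v *)
From mathcomp Require Import all_boot.
From mathcomp Require Import boolp classical_sets.

Set Implicit Arguments.
Unset Strict Implicit.
Unset Printing Implicit Defensive.

Local Open Scope classical_set_scope.

(** Small categories whose hom-types are compared by Leibniz equality. *)

Record category := Category {
  obj : Type;
  hom : obj -> obj -> Type;
  idmap : forall x, hom x x;
  compmap : forall x y z, hom y z -> hom x y -> hom x z;
  compmap1 : forall x y (u : hom x y), compmap u (idmap x) = u;
  comp1map : forall x y (u : hom x y), compmap (idmap y) u = u;
  compmapA : forall x y z t (w : hom z t) (v : hom y z) (u : hom x y),
    compmap w (compmap v u) = compmap (compmap w v) u
}.

Definition is_preorder (C : category) : Prop :=
  forall (x y : obj C) (u v : hom x y), u = v.

Definition word : Type := seq {n : nat | 0 < n}.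

Definition nominal_arity (X : pred word) : Prop :=
  forall a b : word, a \in X -> a ++ b \in X -> b = [::].

Definition dot_arity (a : word) (X : pred word) : pred word :=
  [pred w : word | prefix a w && (drop (size a) w \in X)].

(** Y ◁_a X.  It is only used for a \in Y and X of the form a·Z, all of whose
    members have a as a prefix; see [arity_nominal] below. *)

Definition ins_arity (Y : pred word) (a : word) (X : pred word) : pred word :=
  [pred w : word | (w \in Y) && (w != a) || (w \in X)].

Definition unit_arity : pred word := pred1 [::].

Definition bar_arity (n : nat) : pred word :=
  [pred w : word | if w is [:: i] then val i <= n else false].

(** [Ins g a f] is the insertion of f in g at a.  The syntax is raw: the side
    condition on a is imposed by [is_term] below. *)

Inductive preterm (G : Type) : Type :=
| Gen of G
| Unit
| Ins of preterm G & word & preterm G.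

Arguments Unit {G}.

Declare Scope wo_term_scope.
Delimit Scope wo_term_scope with wt.
Bind Scope wo_term_scope with preterm.
Notation "g ◁[ a ] f" := (Ins g a f)
  (at level 40, a at level 200, left associativity) : wo_term_scope.

(** Raw arrow terms.  Every basic arrow term carries all its indices, so that
    an arrow term has at most one type; typing is [is_arrow] below.  The
    arguments [h b g a f] stand for the indices h,(b,g),(a,f). *)

Inductive prearrow (G : Type) : Type :=
| One of preterm G
| Beta (h : preterm G) (b : word) (g : preterm G) (a : word) (f : preterm G)
| BetaV (h : preterm G) (b : word) (g : preterm G) (a : word) (f : preterm G)
| Theta (h : preterm G) (b : word) (g : preterm G) (a : word) (f : preterm G)
| Mu (f : preterm G) (a : word)
| MuV (f : preterm G) (a : word)
| Lambda (f : preterm G)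
| LambdaV (f : preterm G)
| Comp (v u : prearrow G)
| InsA (v : prearrow G) (a : word) (u : prearrow G).

Declare Scope wo_arrow_scope.
Delimit Scope wo_arrow_scope with wa.
Bind Scope wo_arrow_scope with prearrow.
Notation "v ◁[ a ] u" := (InsA v a u)
  (at level 40, a at level 200, left associativity) : wo_arrow_scope.
Notation "v ∘ u" := (Comp v u)
  (at level 50, left associativity) : wo_arrow_scope.

Section WOe.

Context {G : Type} (alpha : G -> nat).

Implicit Types (f g h j : preterm G) (a b c : word) (u v w : prearrow G).

Fixpoint arity (f : preterm G) : pred word :=
  match f with
  | Gen x => if alpha x == 1 then unit_arity else bar_arity (alpha x)
  | Unit => unit_arity
  | Ins g a f => ins_arity (arity g) a (dot_arity a (arity f))
  end.

Fixpoint is_term (f : preterm G) : bool :=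
  match f with
  | Gen _ => true
  | Unit => true
  | Ins g a f => [&& is_term g, is_term f & a \in arity g]
  end.

Lemma arity_nominal f : is_term f -> nominal_arity (arity f).
Proof.
elim: f => [x _|_|g IHg a f IHf /and3P[/IHg Hg /IHf Hf ag]] /=.
- case: eqP => _ b c; rewrite !inE; first by move=> /eqP-> /eqP.
  by case: b => [|i [|k b]] //= _; case: c.
- by move=> b c; rewrite !inE => /eqP-> /eqP.
move=> b c; rewrite !inE => /orP[/andP[bg /eqP ba]|/andP[/prefixP[d ->]]].
  move=> /orP[/andP[bcg _]|/andP[/prefixP[d e] _]]; first exact: Hg bg bcg.
  have [le_ab|/ltnW le_ba] := leqP (size a) (size b).
    have eb : b = a ++ drop (size a) b.
      rewrite -{1}(cat_take_drop (size a) b); congr (_ ++ _).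
      by rewrite -(takel_cat c le_ab) e take_size_cat.
    by case: ba; move: bg; rewrite eb => /(Hg _ _ ag) ->; rewrite cats0.
  have ea : a = b ++ drop (size b) a.
    rewrite -{1}(cat_take_drop (size b) a); congr (_ ++ _).
    by rewrite -(takel_cat d le_ba) -e take_size_cat.
  case: ba; move: ag; rewrite ea => /(Hg _ _ bg) ->; by rewrite cats0.
rewrite -catA !(drop_size_cat _ erefl) => df.
case/orP=> [/andP[/(Hg _ _ ag) + _]|]; first by case: d df => // _; case: c.
by move=> /andP[_]; apply: Hf.
Qed.

(** [is_arrow u f g]: u is an arrow term of type f -> g. *)

Inductive is_arrow : prearrow G -> preterm G -> preterm G -> Prop :=
| is_arrow_One f : is_term f -> is_arrow (One f) f f
| is_arrow_Beta h b g a f :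
    is_term h -> is_term g -> is_term f -> b \in arity h -> a \in arity g ->
    is_arrow (Beta h b g a f)
      (h ◁[b] g ◁[b ++ a] f) (h ◁[b] (g ◁[a] f))
| is_arrow_BetaV h b g a f :
    is_term h -> is_term g -> is_term f -> b \in arity h -> a \in arity g ->
    is_arrow (BetaV h b g a f)
      (h ◁[b] (g ◁[a] f)) (h ◁[b] g ◁[b ++ a] f)
| is_arrow_Theta h b g a f :
    is_term h -> is_term g -> is_term f ->
    a \in arity h -> b \in arity h -> a != b ->
    is_arrow (Theta h b g a f)
      (h ◁[b] g ◁[a] f) (h ◁[a] f ◁[b] g)
| is_arrow_Mu f a :
    is_term f -> a \in arity f -> is_arrow (Mu f a) (f ◁[a] Unit) f
| is_arrow_MuV f a :
    is_term f -> a \in arity f -> is_arrow (MuV f a) f (f ◁[a] Unit)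
| is_arrow_Lambda f : is_term f -> is_arrow (Lambda f) (Unit ◁[[::]] f) f
| is_arrow_LambdaV f : is_term f -> is_arrow (LambdaV f) f (Unit ◁[[::]] f)
| is_arrow_Comp f g h u v :
    is_arrow u f g -> is_arrow v g h -> is_arrow (v ∘ u) f h
| is_arrow_Ins f f' g g' a u v :
    is_arrow u f f' -> is_arrow v g g' ->
    is_term (g ◁[a] f) -> is_term (g' ◁[a] f') ->
    is_arrow (v ◁[a] u) (g ◁[a] f) (g' ◁[a] f').

(** The defining equations, on raw arrow terms; [arrow_eq] below retains only
    the instances whose two sides are arrow terms of the same type. *)

Inductive arrow_ax : prearrow G -> prearrow G -> Prop :=
| ax_comp1 f u : arrow_ax (u ∘ One f) u
| ax_1comp g u : arrow_ax (One g ∘ u) u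
| ax_compA u v w : arrow_ax (w ∘ (v ∘ u)) (w ∘ v ∘ u)
| ax_ins1 g a f : arrow_ax (One g ◁[a] One f) (One (g ◁[a] f))
| ax_ins_comp u1 u2 v1 v2 a :
    arrow_ax ((v2 ∘ v1) ◁[a] (u2 ∘ u1)) ((v2 ◁[a] u2) ∘ (v1 ◁[a] u1))
| ax_beta_nat f1 f2 g1 g2 h1 h2 u v w a b :
    is_arrow u f1 f2 -> is_arrow v g1 g2 -> is_arrow w h1 h2 ->
    arrow_ax (Beta h2 b g2 a f2 ∘ ((w ◁[b] v) ◁[b ++ a] u))
             ((w ◁[b] (v ◁[a] u)) ∘ Beta h1 b g1 a f1)
| ax_theta_nat f1 f2 g1 g2 h1 h2 u v w a b :
    is_arrow u f1 f2 -> is_arrow v g1 g2 -> is_arrow w h1 h2 ->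
    arrow_ax (Theta h2 b g2 a f2 ∘ ((w ◁[b] v) ◁[a] u))
             (((w ◁[a] u) ◁[b] v) ∘ Theta h1 b g1 a f1)
| ax_betaK h b g a f :
    arrow_ax (BetaV h b g a f ∘ Beta h b g a f)
             (One (h ◁[b] g ◁[b ++ a] f))
| ax_betaVK h b g a f :
    arrow_ax (Beta h b g a f ∘ BetaV h b g a f)
             (One (h ◁[b] (g ◁[a] f)))
| ax_thetaK h b g a f :
    arrow_ax (Theta h a f b g ∘ Theta h b g a f)
             (One (h ◁[b] g ◁[a] f))
| ax_beta_pentagon j c h b g a f :
    arrow_ax
      ((One j ◁[c] Beta h b g a f) ∘ Beta j c (h ◁[b] g) (b ++ a) f
         ∘ (Beta j c h b g ◁[c ++ b ++ a] One f))
      (Beta j c h b (g ◁[a] f) ∘ Beta (j ◁[c] h) (c ++ b) g a f)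
| ax_theta_hexagon j c h b g a f :
    arrow_ax
      (Theta (j ◁[a] f) c h b g ∘ (Theta j c h a f ◁[b] One g)
         ∘ Theta (j ◁[c] h) b g a f)
      ((Theta j b g a f ◁[c] One h) ∘ Theta (j ◁[b] g) c h a f
         ∘ (Theta j c h b g ◁[a] One f))
| ax_beta_theta_inner j c h b g a f :
    arrow_ax
      ((One j ◁[c] Theta h b g a f) ∘ Beta j c (h ◁[b] g) a f
         ∘ (Beta j c h b g ◁[c ++ a] One f))
      (Beta j c (h ◁[a] f) b g ∘ (Beta j c h a f ◁[c ++ b] One g)
         ∘ Theta (j ◁[c] h) (c ++ b) g (c ++ a) f)
| ax_beta_theta_outer j c h b g a f :
    arrow_ax
      (Theta j c (h ◁[b] g) a f ∘ (Beta j c h b g ◁[a] One f))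
      (Beta (j ◁[a] f) c h b g ∘ (Theta j c h a f ◁[c ++ b] One g)
         ∘ Theta (j ◁[c] h) (c ++ b) g a f)
| ax_mu_nat f1 f2 u a :
    is_arrow u f1 f2 ->
    arrow_ax (Mu f2 a ∘ (u ◁[a] One Unit)) (u ∘ Mu f1 a)
| ax_lambda_nat f1 f2 u :
    is_arrow u f1 f2 ->
    arrow_ax (Lambda f2 ∘ (One Unit ◁[[::]] u)) (u ∘ Lambda f1)
| ax_muK f a : arrow_ax (MuV f a ∘ Mu f a) (One (f ◁[a] Unit))
| ax_muVK f a : arrow_ax (Mu f a ∘ MuV f a) (One f)
| ax_lambdaK f : arrow_ax (LambdaV f ∘ Lambda f) (One (Unit ◁[[::]] f))
| ax_lambdaVK f : arrow_ax (Lambda f ∘ LambdaV f) (One f)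
| ax_beta_unit h b f :
    arrow_ax (Beta h b Unit [::] f)
             ((One h ◁[b] LambdaV f) ∘ (Mu h b ◁[b] One f))
| ax_theta_unit h b a f :
    arrow_ax (Theta h b Unit a f)
             (MuV (h ◁[a] f) b ∘ (Mu h b ◁[a] One f)).

(** [arrow_eq f g u v]: the arrow terms u, v : f -> g are equal in the
    equational theory. *)

Inductive arrow_eq :
    preterm G -> preterm G -> prearrow G -> prearrow G -> Prop :=
| arrow_eq_ax f g u v :
    is_arrow u f g -> is_arrow v f g -> arrow_ax u v -> arrow_eq f g u v
| arrow_eq_refl f g u : is_arrow u f g -> arrow_eq f g u u
| arrow_eq_sym f g u v : arrow_eq f g u v -> arrow_eq f g v u
| arrow_eq_trans f g u v w :
    arrow_eq f g u v -> arrow_eq f g v w -> arrow_eq f g u w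
| arrow_eq_comp f g h u u' v v' :
    arrow_eq f g u u' -> arrow_eq g h v v' ->
    arrow_eq f h (v ∘ u) (v' ∘ u')
| arrow_eq_ins f f' g g' a u u' v v' :
    arrow_eq f f' u u' -> arrow_eq g g' v v' ->
    is_term (g ◁[a] f) -> is_term (g' ◁[a] f') ->
    arrow_eq (g ◁[a] f) (g' ◁[a] f') (v ◁[a] u) (v' ◁[a] u').

Definition term : Type := {f : preterm G | is_term f}.

(** An arrow f -> g is an equivalence class of arrow terms of that type. *)

Definition is_class (f g : preterm G) (A : set (prearrow G)) : Prop :=
  exists2 u, is_arrow u f g & A = [set v | arrow_eq f g u v].

Definition arrow (f g : term) : Type := {A | is_class (val f) (val g) A}.

Lemma arrow_inj (f g : term) (A B : arrow f g) :
  proj1_sig A = proj1_sig B -> A = B.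
Proof.
by case: A B => [A pA] [B pB] /= e; case: _ / e pB => pB; congr exist.
Qed.

Lemma class_eq f g u v : arrow_eq f g u v ->
  [set w | arrow_eq f g u w] = [set w | arrow_eq f g v w].
Proof.
move=> uv; apply/seteqP; split=> w /= uw.
  exact: arrow_eq_trans (arrow_eq_sym uv) uw.
exact: arrow_eq_trans uv uw.
Qed.

Definition class (f g : term) u (hu : is_arrow u (val f) (val g)) : arrow f g :=
  exist _ [set v | arrow_eq (val f) (val g) u v]
    (ex_intro2 _ _ u hu erefl).

Definition arrow_id (f : term) : arrow f f := class (is_arrow_One (valP f)).

(** Composition of classes, without choosing representatives: the class of
    v ∘ u for any u in A and v in B. *)

Definition comp_class (f g h : preterm G) (B A : set (prearrow G)) :
    set (prearrow G) :=
  [set w | exists u v, [/\ A u, B v & arrow_eq f h (v ∘ u) w]].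

Lemma comp_classE f g h u v : is_arrow u f g -> is_arrow v g h ->
  comp_class f g h [set w | arrow_eq g h v w] [set w | arrow_eq f g u w]
  = [set w | arrow_eq f h (v ∘ u) w].
Proof.
move=> hu hv; apply/seteqP; split=> w /=.
  case=> u' [v' [uu' vv']]; apply: arrow_eq_trans.
  exact: arrow_eq_comp uu' vv'.
by move=> vuw; exists u, v; split=> //; apply: arrow_eq_refl.
Qed.

Lemma comp_is_class f g h A B : is_class g h B -> is_class f g A ->
  is_class f h (comp_class f g h B A).
Proof.
move=> [v hv ->] [u hu ->]; exists (v ∘ u)%wa; first exact: is_arrow_Comp hu hv.
exact: comp_classE.
Qed.

Definition arrow_comp (f g h : term) (B : arrow g h) (A : arrow f g) :
    arrow f h :=
  exist _ _ (comp_is_class (proj2_sig B) (proj2_sig A)).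

Lemma arrow_comp1 (f g : term) (A : arrow f g) :
  arrow_comp A (arrow_id f) = A.
Proof.
apply: arrow_inj; case: A => A [u hu /= ->].
have h1 := is_arrow_One (valP f).
rewrite comp_classE //; apply: class_eq; apply: arrow_eq_ax => //.
  exact: is_arrow_Comp h1 hu.
exact: ax_comp1.
Qed.

Lemma arrow_1comp (f g : term) (A : arrow f g) :
  arrow_comp (arrow_id g) A = A.
Proof.
apply: arrow_inj; case: A => A [u hu /= ->].
have h1 := is_arrow_One (valP g).
rewrite comp_classE //; apply: class_eq; apply: arrow_eq_ax => //.
  exact: is_arrow_Comp hu h1.
exact: ax_1comp.
Qed.

Lemma arrow_compA (f g h j : term)
    (C : arrow h j) (B : arrow g h) (A : arrow f g) :
  arrow_comp C (arrow_comp B A) = arrow_comp (arrow_comp C B) A.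
Proof.
apply: arrow_inj; case: A B C => A [u hu eA] [B [v hv eB]] [C [w hw eC]] /=.
rewrite {}eA {}eB {}eC.
have hvu := is_arrow_Comp hu hv; have hwv := is_arrow_Comp hv hw.
rewrite !comp_classE //; apply: class_eq; apply: arrow_eq_ax.
- exact: is_arrow_Comp hvu hw.
- exact: is_arrow_Comp hu hwv.
- exact: ax_compA.
Qed.

Definition WOe : category :=
  Category arrow_comp1 arrow_1comp arrow_compA.

End WOe.

(* Main.v *)
Require Import Defs.
From mathcomp Require Import all_boot.
From Stdlib Require Import Setoid Morphisms.

(** The proof evaluates a term inside an arbitrary context.  For a term t with
    a in its arity, [graft t a f] is a term isomorphic to t ◁_a f, obtained by
    inserting the generators of f into t one at a time, and
    [merge t a f : t ◁_a f -> graft t a f] is a canonical isomorphism: β⁻¹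
    splits an insertion g ◁_b k into an insertion of g followed by one of k, μ
    erases a unit, and a generator x inserted last is moved by θ to the left
    past the insertions at positions larger than its own, as in insertion sort
    ([place], [slide]).

    The whole content is [merge_naturality]: for every arrow term
    u : f -> f', the terms graft t a f and graft t a f' are the same, and
    merge t a f' ∘ (1_t ◁_a u) = merge t a f.  This is an induction on u.
    Composition is immediate, insertion is the naturality of β⁻¹, β is the
    pentagon, λ is the axiom that expresses β at a unit, and μ is a
    consequence of these two by the argument of Kelly for monoidal categories
    ([mu_beta]).  For θ one needs that merging two arguments at distinct
    positions commutes with θ ([theta_compatible_all]).  The axioms relating
    θ to β and to units reduce this to the insertion of two single generators
    ([slide_theta]), where the hexagon makes the two insertion sorts agree.

    Taking t = I and a = e, two arrow terms u, v : f -> g satisfy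
    merge I e g ∘ (1 ◁_e u) = merge I e f = merge I e g ∘ (1 ◁_e v).  Every
    arrow is invertible, so 1 ◁_e u = 1 ◁_e v, and u = v by naturality of λ. *)

Set Implicit Arguments.
Unset Strict Implicit.
Unset Printing Implicit Defensive.

Section Coherence.

Context {G : Type} (alpha : G -> nat).

Implicit Types (f g h j k t x y z : preterm G) (a b c d : word).
Implicit Types (u v w p q : prearrow G).

Local Notation arity := (arity alpha).
Local Notation is_term := (is_term alpha).
Local Notation is_arrow := (is_arrow alpha).
Local Notation arrow_eq := (arrow_eq alpha).
Local Notation arrow_ax := (arrow_ax alpha).

Local Open Scope wo_arrow_scope.

(** * Arities and typing *)

Lemma mem_dot a d (X : pred word) : (a ++ d \in dot_arity a X) = (d \in X).
Proof. by rewrite inE prefix_prefix drop_size_cat. Qed.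

Lemma dotP a c (X : pred word) :
  reflect (exists2 d, c = a ++ d & d \in X) (c \in dot_arity a X).
Proof.
apply: (iffP idP) => [|[d -> dX]]; last by rewrite mem_dot.
by rewrite inE => /andP[/prefixP[d ->]]; rewrite drop_size_cat //; exists d.
Qed.

Lemma mem_ins g a f c :
  (c \in arity (g ◁[a] f)) =
  (c \in arity g) && (c != a) || (c \in dot_arity a (arity f)).
Proof. by []. Qed.

Lemma mem_ins_sub g a f d : d \in arity f -> a ++ d \in arity (g ◁[a] f).
Proof. by move=> df; rewrite mem_ins mem_dot df orbT. Qed.

Lemma mem_ins_other g a f c :
  c \in arity g -> c != a -> c \in arity (g ◁[a] f).
Proof. by move=> cg ca; rewrite mem_ins cg ca. Qed.

Lemma is_term_ins g a f :
  is_term g -> is_term f -> a \in arity g -> is_term (g ◁[a] f).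
Proof. by move=> /= -> -> ->. Qed.

(** Distinct members of an arity are incomparable for the prefix order, so a
    position inside an argument at b stays different from any position c. *)
Lemma cat_neq t b d c : is_term t -> b \in arity t -> c \in arity t ->
  b != c -> b ++ d != c.
Proof.
move=> tt bt ct; apply: contraNneq => ebd.
have := arity_nominal tt bt; rewrite -ebd in ct * => /(_ _ ct) ->.
by rewrite cats0.
Qed.

Lemma cat_neq2l a b c : b != c -> a ++ b != a ++ c.
Proof. by elim: a => //= i a IH bc; rewrite eqseq_cons eqxx IH. Qed.

Lemma arity_beta h b g a f : is_term h -> b \in arity h ->
  arity (h ◁[b] g ◁[b ++ a] f) =i arity (h ◁[b] (g ◁[a] f)).
Proof.
move=> th bh c; rewrite !mem_ins.
apply/idP/idP.
  case/orP=> [/andP[/orP[->//|/dotP[d -> dg]]]|/dotP[d -> df]].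
    move=> ne; rewrite mem_dot mem_ins_other ?orbT //.
    by apply: contraNneq ne => ->.
  by rewrite -catA mem_dot mem_ins_sub ?orbT.
case/orP=> [/andP[ch cb]|/dotP[d ->]].
  by rewrite ch cb /= eq_sym (@cat_neq h) // eq_sym.
rewrite mem_ins; case/orP=> [/andP[dg da]|/dotP[e -> ef]].
  by rewrite mem_dot dg orbT cat_neq2l.
by rewrite catA mem_dot ef orbT.
Qed.

Lemma arity_theta_sub h b g a f : is_term h ->
  a \in arity h -> b \in arity h -> a != b ->
  {subset arity (h ◁[b] g ◁[a] f) <= arity (h ◁[a] f ◁[b] g)}.
Proof.
move=> th ah bh ab c; rewrite !mem_ins.
case/orP=> [/andP[/orP[/andP[-> ->] -> //|-> _]]|/dotP[d -> df]].
  by rewrite orbT.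
by rewrite mem_dot df orbT (@cat_neq h).
Qed.

Lemma is_arrow_arity u f g : is_arrow u f g ->
  [/\ is_term f, is_term g & arity f =i arity g].
Proof.
elim=> {u f g} [f tf|h b g a f th tg tf bh ag|h b g a f th tg tf bh ag
  |h b g a f th tg tf ah bh ab|f a tf af|f a tf af|f tf|f tf
  |f g h u v _ [? _ fg] _ [_ ? gh]|f f' g g' a u v _ [_ _ ff] _ [_ _ gg] t t'].
- by [].
- split; last exact: arity_beta.
    by rewrite !is_term_ins ?mem_ins_sub.
  by rewrite !is_term_ins.
- split; last by move=> c; rewrite arity_beta.
    by rewrite !is_term_ins.
  by rewrite !is_term_ins ?mem_ins_sub.
- have ba: b != a by rewrite eq_sym.
  split; first by rewrite !is_term_ins ?mem_ins_other.
    by rewrite !is_term_ins ?mem_ins_other.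
  by move=> c; apply/idP/idP; apply: arity_theta_sub.
- split=> //; first by rewrite is_term_ins.
  move=> c; rewrite mem_ins; apply/idP/idP.
    by case/orP=> [/andP[]//|/dotP[d ->]]; rewrite inE => /eqP->; rewrite cats0.
  move=> cf; rewrite cf /=; case: eqP => //= ->.
  by rewrite -[a in a \in _]cats0 mem_dot.
- split=> //; first by rewrite is_term_ins.
  move=> c; rewrite mem_ins; apply/idP/idP.
    move=> cf; rewrite cf /=; case: eqP => //= ->.
    by rewrite -[a in a \in _]cats0 mem_dot.
  by case/orP=> [/andP[]//|/dotP[d ->]]; rewrite inE => /eqP->; rewrite cats0.
- split=> //; first by rewrite is_term_ins.
  move=> c; rewrite mem_ins -[c]cat0s mem_dot cat0s /=.
  by rewrite inE /= andbN.
- split=> //; first by rewrite is_term_ins.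
  move=> c; rewrite mem_ins -[c]cat0s mem_dot cat0s /=.
  by rewrite inE /= andbN.
- by split=> // c; rewrite fg gh.
split=> // c; rewrite !mem_ins gg; congr (_ || _).
by apply/dotP/dotP=> -[d -> df]; exists d => //; rewrite ?ff // -ff.
Qed.

Lemma is_arrow_unique u f g f' g' :
  is_arrow u f g -> is_arrow u f' g' -> f = f' /\ g = g'.
Proof.
move=> uT; elim: uT f' g' => {u f g} [> ?|> ?????|> ?????|> ??????|> ??|> ??|> ?
  |> ?|f g h u v _ IHu _ IHv|f1 f2 g1 g2 a u v _ IHu _ IHv _ _] f' g' T;
  inversion T; subst=> //.
- match goal with H : is_arrow u _ _, H' : is_arrow v _ _ |- _ =>
    by have [-> _] := IHu _ _ H; have [_ ->] := IHv _ _ H' end.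
- match goal with H : is_arrow u _ _, H' : is_arrow v _ _ |- _ =>
    by have [-> ->] := IHu _ _ H; have [-> ->] := IHv _ _ H' end.
Qed.

Lemma arrow_eq_typed f g u v :
  arrow_eq f g u v -> is_arrow u f g /\ is_arrow v f g.
Proof.
elim=> {f g u v} //.
- by move=> > _ [].
- by move=> > _ [? _] _ [].
- by move=> > _ [? ?] _ [? ?]; split; apply: is_arrow_Comp; eassumption.
- by move=> > _ [? ?] _ [? ?] ? ?; split; apply: is_arrow_Ins.
Qed.

(** * Equality of arrow terms as a total congruence *)

(** Relative to [arrow_eq], types are left implicit and ill-typed arrow terms
    are related as well, vacuously.  The result is reflexive and a congruence on
    all raw arrow terms, hence usable for rewriting; on arrow terms it is
    [arrow_eq], because types are unique. *)
Definition eqv u v :=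
  forall f g, is_arrow u f g \/ is_arrow v f g -> arrow_eq f g u v.

Local Notation "u ≡ v" := (eqv u v) (at level 70).

Lemma eqv_refl u : u ≡ u.
Proof. by move=> f g []; apply: arrow_eq_refl. Qed.

#[local] Hint Resolve eqv_refl : core.

Lemma eqv_sym u v : u ≡ v -> v ≡ u.
Proof. by move=> uv f g /or_comm /uv; apply: arrow_eq_sym. Qed.

Lemma eqv_typed u v f g : u ≡ v -> is_arrow u f g -> is_arrow v f g.
Proof. by move=> uv uT; case: (arrow_eq_typed (uv _ _ (or_introl uT))). Qed.

Lemma eqv_trans u v w : u ≡ v -> v ≡ w -> u ≡ w.
Proof.
move=> uv vw f g H; have vT : is_arrow v f g.
  by case: H => [/(eqv_typed uv)|/(eqv_typed (eqv_sym vw))].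
by apply: arrow_eq_trans (uv _ _ (or_intror vT)) (vw _ _ (or_introl vT)).
Qed.

#[local] Instance eqv_equivalence : Equivalence eqv.
Proof. split; [exact: eqv_refl|exact: eqv_sym|exact: eqv_trans]. Qed.

#[local] Instance comp_eqv : Proper (eqv ==> eqv ==> eqv) (@Comp G).
Proof.
move=> v v' vv u u' uu f h [T|T]; inversion T; subst;
  apply: arrow_eq_comp; [apply: uu|apply: vv|apply: uu|apply: vv];
  by [left; eassumption|right; eassumption].
Qed.

#[local] Instance insA_eqv :
  Proper (eqv ==> eq ==> eqv ==> eqv) (@InsA G).
Proof.
move=> v v' vv a _ <- u u' uu f h [T|T]; inversion T; subst;
  apply: arrow_eq_ins => //; [apply: uu|apply: vv|apply: uu|apply: vv];
  by [left; eassumption|right; eassumption].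
Qed.

Lemma eqv_ax f g u v :
  is_arrow u f g -> is_arrow v f g -> arrow_ax u v -> u ≡ v.
Proof.
move=> uT vT uv f' g' [T|T].
  by have [<- <-] := is_arrow_unique uT T; apply: arrow_eq_ax.
by have [<- <-] := is_arrow_unique vT T; apply: arrow_eq_ax.
Qed.

Lemma mem_ins_unit t a : a \in arity t -> a \in arity (t ◁[a] Unit).
Proof. by move=> at_; rewrite -[a in a \in _]cats0 mem_ins_sub. Qed.

Lemma mem_ins_sub2 t c b g a :
  a \in arity g -> c ++ b ++ a \in arity (t ◁[c ++ b] g).
Proof. by rewrite catA; apply: mem_ins_sub. Qed.

#[local] Hint Constructors Defs.is_arrow : wo.
#[local] Hint Resolve is_term_ins mem_ins_sub mem_ins_other
  mem_ins_unit mem_ins_sub2 : wo.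
#[local] Hint Extern 1 (is_true (_ \in Defs.arity _ Unit)) => exact: eqxx : wo.
#[local] Hint Extern 1 (is_true (Defs.is_term _ Unit)) => exact: isT : wo.
#[local] Hint Extern 1 (is_true (_ != _)) => rewrite eq_sym; assumption : wo.

(* The search must follow the syntax of the arrow term: the intermediate objects
   of a composite are then known when its membership conditions are reached. *)
Local Ltac ty :=
  lazymatch goal with
  | |- Defs.is_arrow _ (_ ∘ _) _ _ => eapply is_arrow_Comp; [ty | ty]
  | |- Defs.is_arrow _ (_ ◁[_] _) _ _ =>
      eapply is_arrow_Ins; [ty | ty | ty | ty]
  | |- Defs.is_arrow _ (One _) _ _ => eapply is_arrow_One; ty
  | |- _ => eauto 12 with wo
  end.
Local Ltac ax := eapply eqv_ax; [ty | ty | constructor; ty].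

(** Either side being typed forces the other one to be, so neither this
    equation nor the functoriality equations below have typing hypotheses. *)
Lemma compA w v u : w ∘ (v ∘ u) ≡ w ∘ v ∘ u.
Proof.
move=> f g [T|T]; (apply: arrow_eq_ax; last exact: ax_compA).
- by [].
- inversion T; subst; match goal with H : is_arrow (v ∘ u) _ _ |- _ =>
    inversion H; subst end; ty.
- inversion T; subst; match goal with H : is_arrow (w ∘ v) _ _ |- _ =>
    inversion H; subst end; ty.
- by [].
Qed.

Arguments compA : clear implicits.

Lemma comp1 f g u : is_arrow u f g -> u ∘ One f ≡ u.
Proof.
move=> T; have [? ? _] := is_arrow_arity T.
by ax.
Qed.

Lemma comp1l f g u : is_arrow u f g -> One g ∘ u ≡ u.
Proof.
move=> T; have [? ? _] := is_arrow_arity T.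
by ax.
Qed.

Lemma comp11 f : One f ∘ One f ≡ One f.
Proof.
move=> g h T; have tf : is_term f.
  by case: T => T; inversion T; subst=> //;
    match goal with H : is_arrow _ _ _ |- _ => by inversion H end.
apply: (comp1 (f := f) (g := f)); first exact: is_arrow_One.
by [].
Qed.

Lemma ins1 g a f : One g ◁[a] One f ≡ One (g ◁[a] f).
Proof.
have [tgf|ntgf] := boolP (is_term (g ◁[a] f)).
  case/and3P: (tgf) => tg tf ag.
  by ax.
move=> g' f' [T|T]; case/negP: ntgf; inversion T; subst=> //.
repeat match goal with H : is_arrow (One _) _ _ |- _ => inversion H; subst; clear H end.
by [].
Qed.

Lemma is_term_insE g a f :
  is_term (g ◁[a] f) = [&& is_term g, is_term f & a \in arity g].
Proof. by []. Qed.

Lemma ins_comp v2 v1 a u2 u1 :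
  (v2 ∘ v1) ◁[a] (u2 ∘ u1) ≡ (v2 ◁[a] u2) ∘ (v1 ◁[a] u1).
Proof.
move=> f g [T|T]; (apply: arrow_eq_ax; last exact: ax_ins_comp).
- by [].
- inversion T; subst.
  repeat match goal with H : is_arrow (_ ∘ _) _ _ |- _ =>
    inversion H; subst; clear H end.
  match goal with Hu : is_arrow u1 _ _, Hv : is_arrow v1 _ _ |- _ =>
    have [_ tu _] := is_arrow_arity Hu; have [_ tv ev] := is_arrow_arity Hv end.
  match goal with H : is_true (Defs.is_term _ (_ ◁[a] _)%wt) |- _ =>
    case/and3P: (H) => _ _; rewrite ev => ? end.
  ty.
- inversion T; subst.
  repeat match goal with H : is_arrow (_ ◁[_] _) _ _ |- _ =>
    inversion H; subst; clear H end.
  ty.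
- by [].
Qed.

Lemma ins_compl v2 v1 a f :
  (v2 ∘ v1) ◁[a] One f ≡ (v2 ◁[a] One f) ∘ (v1 ◁[a] One f).
Proof. by rewrite -ins_comp comp11. Qed.

Lemma ins_compr g a u2 u1 :
  One g ◁[a] (u2 ∘ u1) ≡ (One g ◁[a] u2) ∘ (One g ◁[a] u1).
Proof. by rewrite -ins_comp comp11. Qed.

Lemma ins_split_r g1 g2 f1 f2 v a u : is_arrow v g1 g2 -> is_arrow u f1 f2 ->
  v ◁[a] u ≡ (One g2 ◁[a] u) ∘ (v ◁[a] One f1).
Proof. by move=> vT uT; rewrite -ins_comp (comp1l vT) (comp1 uT). Qed.

(** Composites are kept associated to the left; this and the next lemma rewrite
    the last two or three factors after an arbitrary prefix. *)
Lemma comp_tail v u w : v ∘ u ≡ w -> forall p, p ∘ v ∘ u ≡ p ∘ w.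
Proof. by move=> e x; rewrite -compA e. Qed.

Lemma comp_tail3 u v w q : w ∘ v ∘ u ≡ q ->
  forall p, p ∘ w ∘ v ∘ u ≡ p ∘ q.
Proof. by move=> e p; rewrite -e !compA. Qed.

(** * Inverses *)

(** The typing is part of the notion, so that inverses can be cancelled on
    either side. *)
Definition inverse f g u u' :=
  [/\ is_arrow u f g, is_arrow u' g f, u' ∘ u ≡ One f & u ∘ u' ≡ One g].

Lemma inverse_sym f g u u' : inverse f g u u' -> inverse g f u' u.
Proof. by case. Qed.

Lemma inverse_one f : is_term f -> inverse f f (One f) (One f).
Proof. by split; rewrite ?comp11 //; ty. Qed.

Lemma inverse_beta h b g a f : is_term h -> is_term g -> is_term f ->
  b \in arity h -> a \in arity g ->
  inverse (h ◁[b] g ◁[b ++ a] f) (h ◁[b] (g ◁[a] f))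
    (Beta h b g a f) (BetaV h b g a f).
Proof. by move=> *; split; [ty|ty|ax|ax]. Qed.

Lemma inverse_theta h b g a f : is_term h -> is_term g -> is_term f ->
  a \in arity h -> b \in arity h -> a != b ->
  inverse (h ◁[b] g ◁[a] f) (h ◁[a] f ◁[b] g)
    (Theta h b g a f) (Theta h a f b g).
Proof. by move=> *; split; [ty|ty|ax|ax]. Qed.

Lemma inverse_mu f a : is_term f -> a \in arity f ->
  inverse (f ◁[a] Unit) f (Mu f a) (MuV f a).
Proof. by move=> *; split; [ty|ty|ax|ax]. Qed.

Lemma inverse_lambda f : is_term f ->
  inverse (Unit ◁[[::]] f) f (Lambda f) (LambdaV f).
Proof. by move=> *; split; [ty|ty|ax|ax]. Qed.

Lemma inverse_comp f g h u u' v v' : inverse f g u u' -> inverse g h v v' ->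
  inverse f h (v ∘ u) (u' ∘ v').
Proof.
move=> [uT uT' uK uK'] [vT vT' vK vK']; split; [ty|ty| |].
  by rewrite compA (comp_tail vK) (comp1 uT').
by rewrite compA (comp_tail uK') (comp1 vT).
Qed.

Lemma inverse_ins f f' g g' u u' v v' a : a \in arity g ->
  inverse f f' u u' -> inverse g g' v v' ->
  inverse (g ◁[a] f) (g' ◁[a] f') (v ◁[a] u) (v' ◁[a] u').
Proof.
move=> ag [uT uT' uK uK'] [vT vT' vK vK'].
have [? ? _] := is_arrow_arity uT; have [? ? gg] := is_arrow_arity vT.
have ag' : a \in arity g' by rewrite -gg.
split; [ty|ty| |].
  by rewrite -ins_comp uK vK ins1.
by rewrite -ins_comp uK' vK' ins1.
Qed.

Lemma inverse_exists f g u : is_arrow u f g -> exists u', inverse f g u u'.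
Proof.
elim=> {f g u}.
- by move=> f tf; exists (One f); apply: inverse_one.
- by move=> h b g a f *; exists (BetaV h b g a f); apply: inverse_beta.
- move=> h b g a f *; exists (Beta h b g a f).
  exact/inverse_sym/inverse_beta.
- by move=> h b g a f *; exists (Theta h a f b g); apply: inverse_theta.
- by move=> f a *; exists (MuV f a); apply: inverse_mu.
- by move=> f a *; exists (Mu f a); apply/inverse_sym/inverse_mu.
- by move=> f *; exists (LambdaV f); apply: inverse_lambda.
- by move=> f *; exists (Lambda f); apply/inverse_sym/inverse_lambda.
- move=> f g h u v _ [u' uI] _ [v' vI]; exists (u' ∘ v').
  exact: inverse_comp uI vI.
move=> f f' g g' a u v _ [u' uI] _ [v' vI] /and3P[_ _ ag] _.
by exists (v' ◁[a] u'); apply: inverse_ins.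
Qed.

Lemma comp_injl f g h u v w : is_arrow w g h -> is_arrow u f g ->
  is_arrow v f g -> w ∘ u ≡ w ∘ v -> u ≡ v.
Proof.
move=> /inverse_exists[w' [_ _ wK _]] uT vT e.
by rewrite -(comp1l uT) -(comp1l vT) -wK -!compA e.
Qed.

Lemma comp_injr f g h u v w : is_arrow w f g -> is_arrow u g h ->
  is_arrow v g h -> u ∘ w ≡ v ∘ w -> u ≡ v.
Proof.
move=> /inverse_exists[w' [_ _ _ wK]] uT vT e.
by rewrite -(comp1 uT) -(comp1 vT) -wK !compA e.
Qed.

(** Reversing the vertical sides of a commuting square.  The axioms are stated
    with β, while [merge] uses β⁻¹; all the translations go through this. *)
Lemma inverse_square f g f' g' u v p p' q q' :
  inverse f g p p' -> inverse f' g' q q' ->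
  is_arrow u f f' -> is_arrow v g g' ->
  q ∘ u ≡ v ∘ p -> q' ∘ v ≡ u ∘ p'.
Proof.
move=> [_ _ _ pK] [_ _ qK _] uT vT e.
by rewrite -(comp1 vT) -pK (compA v) -e !compA qK (comp1l uT).
Qed.

(** * Naturality *)

Section Naturality.

Variables (f1 f2 g1 g2 h1 h2 : preterm G) (u v w : prearrow G) (b a : word).
Hypotheses (uT : is_arrow u f1 f2) (vT : is_arrow v g1 g2)
  (wT : is_arrow w h1 h2) (bh1 : b \in arity h1).

Let tf1 : is_term f1. Proof. by have [] := is_arrow_arity uT. Qed.
Let tf2 : is_term f2. Proof. by have [] := is_arrow_arity uT. Qed.
Let tg1 : is_term g1. Proof. by have [] := is_arrow_arity vT. Qed.
Let tg2 : is_term g2. Proof. by have [] := is_arrow_arity vT. Qed.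
Let th1 : is_term h1. Proof. by have [] := is_arrow_arity wT. Qed.
Let th2 : is_term h2. Proof. by have [] := is_arrow_arity wT. Qed.
Let bh2 : b \in arity h2.
Proof. by have [_ _ <-] := is_arrow_arity wT. Qed.

Lemma beta_nat : a \in arity g1 ->
  Beta h2 b g2 a f2 ∘ ((w ◁[b] v) ◁[b ++ a] u)
  ≡ (w ◁[b] (v ◁[a] u)) ∘ Beta h1 b g1 a f1.
Proof.
move=> ag1; have ag2 : a \in arity g2 by have [_ _ <-] := is_arrow_arity vT.
ax.
Qed.

Lemma betaV_nat : a \in arity g1 ->
  BetaV h2 b g2 a f2 ∘ (w ◁[b] (v ◁[a] u))
  ≡ ((w ◁[b] v) ◁[b ++ a] u) ∘ BetaV h1 b g1 a f1.
Proof.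
move=> ag1; have ag2 : a \in arity g2 by have [_ _ <-] := is_arrow_arity vT.
apply: inverse_square (beta_nat ag1); by [apply: inverse_beta|ty].
Qed.

Lemma theta_nat : a \in arity h1 -> a != b ->
  Theta h2 b g2 a f2 ∘ ((w ◁[b] v) ◁[a] u)
  ≡ ((w ◁[a] u) ◁[b] v) ∘ Theta h1 b g1 a f1.
Proof.
move=> ah1 ab; have ah2 : a \in arity h2 by have [_ _ <-] := is_arrow_arity wT.
ax.
Qed.

Lemma mu_nat : Mu h2 b ∘ (w ◁[b] One Unit) ≡ w ∘ Mu h1 b.
Proof. by ax. Qed.

Lemma lambda_nat : Lambda f2 ∘ (One Unit ◁[[::]] u) ≡ u ∘ Lambda f1.
Proof. by ax. Qed.

End Naturality.

(** * Coherence conditions *)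

Section Conditions.

Variables (j h g f : preterm G) (c b a : word).
Hypotheses (tj : is_term j) (th : is_term h) (tg : is_term g) (tf : is_term f)
  (cj : c \in arity j) (bh : b \in arity h).

(** The positions of β at j ◁_c h are (c ++ b) ++ a and those of the other
    arrows of the pentagon c ++ (b ++ a); the types only agree up to
    associativity of concatenation. *)
Lemma inverse_beta_cat : a \in arity g ->
  inverse (j ◁[c] h ◁[c ++ b] g ◁[c ++ b ++ a] f)
    (j ◁[c] h ◁[c ++ b] (g ◁[a] f))
    (Beta (j ◁[c] h) (c ++ b) g a f) (BetaV (j ◁[c] h) (c ++ b) g a f).
Proof. by move=> ag; rewrite catA; apply: inverse_beta; ty. Qed.

Lemma pentagon : a \in arity g ->
  (One j ◁[c] Beta h b g a f) ∘ Beta j c (h ◁[b] g) (b ++ a) f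
    ∘ (Beta j c h b g ◁[c ++ b ++ a] One f)
  ≡ Beta j c h b (g ◁[a] f) ∘ Beta (j ◁[c] h) (c ++ b) g a f.
Proof.
move=> ag; eapply eqv_ax; [ty| |constructor].
by have [T _ _ _] := inverse_beta_cat ag; eapply is_arrow_Comp; [exact: T|ty].
Qed.

Lemma pentagonV : a \in arity g ->
  BetaV (j ◁[c] h) (c ++ b) g a f ∘ BetaV j c h b (g ◁[a] f)
    ∘ (One j ◁[c] Beta h b g a f)
  ≡ (BetaV j c h b g ◁[c ++ b ++ a] One f)
    ∘ BetaV j c (h ◁[b] g) (b ++ a) f.
Proof.
move=> ag.
have I1 := inverse_beta_cat ag.
have Ig : inverse (j ◁[c] h ◁[c ++ b] g ◁[c ++ b ++ a] f)
    (j ◁[c] (h ◁[b] (g ◁[a] f)))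
    (Beta j c h b (g ◁[a] f) ∘ Beta (j ◁[c] h) (c ++ b) g a f)
    (BetaV (j ◁[c] h) (c ++ b) g a f ∘ BetaV j c h b (g ◁[a] f)).
  by apply: (inverse_comp I1); apply: inverse_beta; ty.
have Ip : inverse (j ◁[c] h ◁[c ++ b] g ◁[c ++ b ++ a] f)
    (j ◁[c] (h ◁[b] g ◁[b ++ a] f))
    (Beta j c (h ◁[b] g) (b ++ a) f ∘ (Beta j c h b g ◁[c ++ b ++ a] One f))
    ((BetaV j c h b g ◁[c ++ b ++ a] One f) ∘ BetaV j c (h ◁[b] g) (b ++ a) f).
  apply: inverse_comp; last by apply: inverse_beta; ty.
  by rewrite catA; apply: inverse_ins; [ty|apply: inverse_one|apply: inverse_beta].
rewrite (inverse_square Ip Ig (u := One (j ◁[c] h ◁[c ++ b] g ◁[c ++ b ++ a] f))).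
- by case: Ip => _ T _ _; rewrite (comp1l T).
- by rewrite catA; ty.
- by ty.
by case: (Ig) => T _ _ _; rewrite (comp1 T) compA pentagon.
Qed.

Hypotheses (aj : a \in arity j) (ac : a != c).

Lemma beta_theta_outer :
  Theta j c (h ◁[b] g) a f ∘ (Beta j c h b g ◁[a] One f)
  ≡ Beta (j ◁[a] f) c h b g ∘ (Theta j c h a f ◁[c ++ b] One g)
    ∘ Theta (j ◁[c] h) (c ++ b) g a f.
Proof.
have ne : a != c ++ b by rewrite eq_sym (@cat_neq j) // eq_sym.
by eapply eqv_ax; [ty|ty|constructor].
Qed.

Lemma betaV_theta_outer :
  BetaV (j ◁[a] f) c h b g ∘ Theta j c (h ◁[b] g) a f
  ≡ (Theta j c h a f ◁[c ++ b] One g) ∘ Theta (j ◁[c] h) (c ++ b) g a f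
    ∘ (BetaV j c h b g ◁[a] One f).
Proof.
have ne : a != c ++ b by rewrite eq_sym (@cat_neq j) // eq_sym.
apply: (inverse_square (f := j ◁[c] h ◁[c ++ b] g ◁[a] f)
  (g := j ◁[c] (h ◁[b] g) ◁[a] f) (f' := j ◁[a] f ◁[c] h ◁[c ++ b] g)
  (p := Beta j c h b g ◁[a] One f) (q := Beta (j ◁[a] f) c h b g)).
- by apply: inverse_ins; [ty|apply: inverse_one|apply: inverse_beta].
- by apply: inverse_beta; ty.
- by ty.
- by ty.
by rewrite compA beta_theta_outer.
Qed.

End Conditions.

Lemma beta_theta_inner j h g f c b a :
  is_term j -> is_term h -> is_term g -> is_term f ->
  c \in arity j -> b \in arity h -> a \in arity h -> a != b ->
  (One j ◁[c] Theta h b g a f) ∘ Beta j c (h ◁[b] g) a f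
    ∘ (Beta j c h b g ◁[c ++ a] One f)
  ≡ Beta j c (h ◁[a] f) b g ∘ (Beta j c h a f ◁[c ++ b] One g)
    ∘ Theta (j ◁[c] h) (c ++ b) g (c ++ a) f.
Proof.
move=> tj th tg tf cj bh ah ab.
have ne := cat_neq2l c ab.
by eapply eqv_ax; [ty|ty|constructor].
Qed.

Lemma betaV_theta_inner j h g f c b a :
  is_term j -> is_term h -> is_term g -> is_term f ->
  c \in arity j -> b \in arity h -> a \in arity h -> a != b ->
  (BetaV j c h a f ◁[c ++ b] One g) ∘ BetaV j c (h ◁[a] f) b g
    ∘ (One j ◁[c] Theta h b g a f)
  ≡ Theta (j ◁[c] h) (c ++ b) g (c ++ a) f
    ∘ (BetaV j c h b g ◁[c ++ a] One f) ∘ BetaV j c (h ◁[b] g) a f.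
Proof.
move=> tj th tg tf cj bh ah ab.
have ne := cat_neq2l c ab.
have I x y d e : is_term x -> is_term y -> d \in arity h -> e \in arity h ->
    e != d ->
    inverse (j ◁[c] h ◁[c ++ d] x ◁[c ++ e] y) (j ◁[c] (h ◁[d] x ◁[e] y))
     (Beta j c (h ◁[d] x) e y ∘ (Beta j c h d x ◁[c ++ e] One y))
     ((BetaV j c h d x ◁[c ++ e] One y) ∘ BetaV j c (h ◁[d] x) e y).
  move=> tx ty_ dh eh de; have ne' := cat_neq2l c de.
  apply: inverse_comp; last by apply: inverse_beta; ty.
  by apply: inverse_ins; [ty|apply: inverse_one|apply: inverse_beta].
have ba : b != a by rewrite eq_sym.
rewrite -!(compA (Theta _ _ _ _ _)).
apply: (inverse_square (I g f b a _ _ _ _ _) (I f g a b _ _ _ _ _)) => //.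
- by ty.
- by ty.
by rewrite -beta_theta_inner // compA.
Qed.

Lemma hexagon j h g f c b a :
  is_term j -> is_term h -> is_term g -> is_term f ->
  c \in arity j -> b \in arity j -> a \in arity j ->
  a != b -> a != c -> b != c ->
  Theta (j ◁[a] f) c h b g ∘ (Theta j c h a f ◁[b] One g)
    ∘ Theta (j ◁[c] h) b g a f
  ≡ (Theta j b g a f ◁[c] One h) ∘ Theta (j ◁[b] g) c h a f
    ∘ (Theta j c h b g ◁[a] One f).
Proof. by move=> *; eapply eqv_ax; [ty|ty|constructor]. Qed.

Lemma triangle h f b : is_term h -> is_term f -> b \in arity h ->
  (One h ◁[b] Lambda f) ∘ Beta h b Unit [::] f ≡ Mu h b ◁[b] One f.
Proof.
move=> th tf bh.
have T := is_arrow_Beta (alpha := alpha) (h := h) (b := b) (g := Unit)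
  (a := [::]) (f := f) th isT tf bh isT.
rewrite cats0 in T.
have -> : Beta h b Unit [::] f ≡ (One h ◁[b] LambdaV f) ∘ (Mu h b ◁[b] One f).
  by eapply eqv_ax; [exact: T|ty|constructor].
have [_ _ _ K] := inverse_lambda tf.
rewrite compA -ins_compr K ins1.
by apply: (comp1l (f := h ◁[b] Unit ◁[b] f)); ty.
Qed.

Lemma theta_unit h b a f : is_term h -> is_term f ->
  b \in arity h -> a \in arity h -> a != b ->
  Mu (h ◁[a] f) b ∘ Theta h b Unit a f ≡ Mu h b ◁[a] One f.
Proof.
move=> th tf bh ah ab.
have -> : Theta h b Unit a f ≡ MuV (h ◁[a] f) b ∘ (Mu h b ◁[a] One f) by ax.
have I : inverse (h ◁[a] f ◁[b] Unit) (h ◁[a] f) (Mu (h ◁[a] f) b)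
    (MuV (h ◁[a] f) b) by apply: inverse_mu; ty.
have [_ _ _ K] := I.
by rewrite compA K; apply: (comp1l (f := h ◁[b] Unit ◁[a] f)); ty.
Qed.

(** By naturality of μ, insertion of a unit at a fixed position is isomorphic to
    the identity functor, hence faithful. *)
Lemma ins_unit_inj f g u v c : is_arrow u f g -> is_arrow v f g ->
  c \in arity f -> u ◁[c] One Unit ≡ v ◁[c] One Unit -> u ≡ v.
Proof.
move=> uT vT cf e; have [tf _ _] := is_arrow_arity uT.
apply: (comp_injr (w := Mu f c) _ uT vT); first by ty.
by rewrite -(mu_nat uT cf) -(mu_nat vT cf) e.
Qed.

(* Kelly's argument *)
(** The unit law for β on the right.  As in the argument of Kelly for monoidal
    categories, it suffices to compare both sides after insertion of one more
    unit and composition with the invertible β: the pentagon for h, g, I, I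
    and two instances of [triangle] then give the equality. *)
Lemma mu_beta h b g a : is_term h -> is_term g ->
  b \in arity h -> a \in arity g ->
  (One h ◁[b] Mu g a) ∘ Beta h b g a Unit ≡ Mu (h ◁[b] g) (b ++ a).
Proof.
move=> th tg bh ag; set I := @Unit G.
have LT : is_arrow ((One h ◁[b] Mu g a) ∘ Beta h b g a I)
    (h ◁[b] g ◁[b ++ a] I) (h ◁[b] g) by ty.
have B0 x d : is_term x -> d \in arity x ->
    is_arrow (Beta x d I [::] I) (x ◁[d] I ◁[d] I) (x ◁[d] (I ◁[[::]] I)).
  move=> tx dx; rewrite -[X in (_ ◁[X] I)%wt]cats0.
  by apply: is_arrow_Beta.
apply: (ins_unit_inj (c := b ++ a) LT); [by ty|by ty|].
have RT : is_arrow (Mu (h ◁[b] g) (b ++ a) ◁[b ++ a] One I)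
    (h ◁[b] g ◁[b ++ a] I ◁[b ++ a] I) (h ◁[b] g ◁[b ++ a] I) by ty.
have LT' : is_arrow (((One h ◁[b] Mu g a) ∘ Beta h b g a I) ◁[b ++ a] One I)
    (h ◁[b] g ◁[b ++ a] I ◁[b ++ a] I) (h ◁[b] g ◁[b ++ a] I) by ty.
apply: (comp_injl (w := Beta h b g a I) _ LT' RT); first by ty.
have muT : is_arrow (Mu g a) (g ◁[a] I) g by ty.
have lT : is_arrow (Lambda I) (I ◁[[::]] I) I by ty.
have oneh : is_arrow (One h) h h by ty.
have oneg : is_arrow (One g) g g by ty.
have oneI : is_arrow (One I) I I by ty.
have P := pentagon (j := h) (h := g) (g := I) (f := I) (c := b) (b := a)
  (a := [::]) th tg isT isT bh ag isT.
rewrite !cats0 in P.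
rewrite ins_compl compA (beta_nat oneI muT oneh) //; last by ty.
rewrite -triangle // ins_compr -!compA (compA (One h ◁[b] Beta _ _ _ _ _)) P.
rewrite compA -(beta_nat lT oneg oneh) // ins1 -compA.
by rewrite triangle //; ty.
Qed.

(** * Sorting *)

(** An injective map that is increasing from the prefix order to the usual order
    of numbers.  Thus an insertion at a position with a smaller key never takes
    place inside the previous argument, and θ applies to the two. *)
Definition key a : nat := CodeSeq.code (map val a).

Lemma key_inj : injective key.
Proof.
move=> a b /(congr1 CodeSeq.decode); rewrite !CodeSeq.codeK.
exact: (inj_map val_inj).
Qed.

Lemma key_cat a d : key a <= key (a ++ d).
Proof.
rewrite /key map_cat; elim: (map val a) => //= n s IH.
by rewrite leq_mul // ltnS leq_double.
Qed.

(** The insertion of x is moved to the left past the insertions with larger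
    keys.  Only the outermost run of such insertions matters: t is not assumed
    to be sorted, nor are its arguments or x assumed to be generators. *)
Fixpoint place t a x : preterm G :=
  if t is Ins t' b y then
    if key a < key b then (place t' a x ◁[b] y)%wt else (t ◁[a] x)%wt
  else (t ◁[a] x)%wt.

Fixpoint slide t a x : prearrow G :=
  if t is Ins t' b y then
    if key a < key b then (slide t' a x ◁[b] One y) ∘ Theta t' b y a x
    else One (t ◁[a] x)
  else One (t ◁[a] x).

Lemma mem_ins_lt t b y a : a \in arity (t ◁[b] y) -> key a < key b ->
  a \in arity t /\ a != b.
Proof.
rewrite mem_ins; case/orP=> [/andP[]//|/dotP[d -> _]].
by rewrite ltnNge key_cat.
Qed.

Lemma is_arrow_slide t a x : is_term t -> is_term x -> a \in arity t ->
  is_arrow (slide t a x) (t ◁[a] x) (place t a x).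
Proof.
move=> tt tx; elim: t tt => [z|| t IH b y _] tt at_; rewrite /=;
  try by apply: is_arrow_One; apply: is_term_ins.
case: ifP => [lt_ab|_]; last by apply: is_arrow_One; apply: is_term_ins.
have [at' ab] := mem_ins_lt at_ lt_ab; case/and3P: tt => tt ty_ bt.
have T := IH tt at'; have [_ tp ep] := is_arrow_arity T.
apply: is_arrow_Comp; first by apply: is_arrow_Theta.
apply: is_arrow_Ins; [by apply: is_arrow_One|exact: T|by ty|].
by apply: is_term_ins => //; rewrite -ep; ty.
Qed.

(** An argument at c inserted into such a t stays outermost. *)
Definition late t c := if t is Ins _ b _ then key b <= key c else true.

Lemma place_late t c z : late t c -> place t c z = (t ◁[c] z)%wt.
Proof. by case: t => //= t b y; rewrite leqNgt; case: ifP. Qed.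

Lemma slide_late t c z : late t c -> slide t c z = One (t ◁[c] z).
Proof. by case: t => //= t b y; rewrite leqNgt; case: ifP. Qed.

Lemma late_place t a x c : key a < key c -> late t c -> late (place t a x) c.
Proof.
move=> /ltnW ac; case: t => [?|//|t b y] //=.
by case: ifP.
Qed.

(** Inserting x at the smaller position a after z at c begins with the
    exchange of the two, which is all that distinguishes the two sides. *)
Lemma slide_theta_late t a x c z : is_term t -> is_term x -> is_term z ->
  a \in arity t -> c \in arity t -> key a < key c -> late t c ->
  place (place t a x) c z = place (place t c z) a x /\
  slide (place t c z) a x ∘ (slide t c z ◁[a] One x) ≡
  slide (place t a x) c z ∘ (slide t a x ◁[c] One z) ∘ Theta t c z a x.
Proof.
move=> tt tx tz at_ ct lt_ac lat.
have ne_ac : a != c by apply: contraTneq lt_ac => ->; rewrite ltnn.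
have lat' := late_place x lt_ac lat.
rewrite !(place_late z lat) !(place_late z lat') (slide_late z lat).
rewrite (slide_late z lat') /= lt_ac; split=> //.
have Ts := is_arrow_slide tt tx at_; have [_ tp ep] := is_arrow_arity Ts.
have cp : c \in arity (place t a x) by rewrite -ep; ty.
have T1 : is_arrow ((slide t a x ◁[c] One z) ∘ Theta t c z a x)
  (t ◁[c] z ◁[a] x) (place t a x ◁[c] z) by ty.
have T2 : is_arrow (slide t a x ◁[c] One z) (t ◁[a] x ◁[c] z)
  (place t a x ◁[c] z) by ty.
by rewrite ins1 (comp1 T1) (comp1l T2).
Qed.

(** When the outermost insertion of t, of y at b, has a key larger than both a
    and c, both arguments are exchanged with y; the hexagon for x, y and z
    reduces the equation to the one for t without y. *)
Lemma slide_theta_lt t a x c z : is_term t -> is_term x -> is_term z ->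
  a \in arity t -> c \in arity t -> key a < key c ->
  place (place t a x) c z = place (place t c z) a x /\
  slide (place t c z) a x ∘ (slide t c z ◁[a] One x) ≡
  slide (place t a x) c z ∘ (slide t a x ◁[c] One z) ∘ Theta t c z a x.
Proof.
move=> tt tx tz at_ ct lt_ac.
have ne_ac : a != c by apply: contraTneq lt_ac => ->; rewrite ltnn.
elim: t tt at_ ct => [y|| t IH b y _] tt at_ ct; try exact: slide_theta_late.
have [lt_cb|le_bc] := ltnP (key c) (key b); last exact: slide_theta_late.
have lt_ab := ltn_trans lt_ac lt_cb.
have [at' ne_ab] := mem_ins_lt at_ lt_ab.
have [ct' ne_cb] := mem_ins_lt ct lt_cb.
rewrite /= lt_cb lt_ab /= lt_cb lt_ab.
rewrite is_term_insE in tt; case/and3P: tt => tt ty_ bt.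
have [btc atc] : b \in arity (t ◁[c] z) /\ a \in arity (t ◁[c] z) by split; ty.
have [bta cta] : b \in arity (t ◁[a] x) /\ c \in arity (t ◁[a] x) by split; ty.
have [Tcz Tax] := (is_arrow_slide tt tz ct', is_arrow_slide tt tx at').
have oney : is_arrow (One y) y y by ty.
have onex : is_arrow (One x) x x by ty.
have onez : is_arrow (One z) z z by ty.
have [-> E] := IH tt at' ct'.
split=> //.
rewrite !ins_compl !compA (comp_tail (theta_nat onex oney Tcz btc atc ne_ab)).
rewrite (comp_tail (theta_nat onez oney Tax bta cta ne_cb)) !compA -!ins_compl E.
rewrite !ins_compl -!(compA _ (Theta _ b _ _ _)).
rewrite -!(compA (_ ◁[b] One y ∘ _ ◁[b] One y)); f_equiv.
by rewrite hexagon // compA.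
Qed.

(** The case of the opposite order follows by inverting θ. *)
Lemma slide_theta t b y c x : is_term t -> is_term y -> is_term x ->
  b \in arity t -> c \in arity t -> b != c ->
  place (place t b y) c x = place (place t c x) b y /\
  slide (place t b y) c x ∘ (slide t b y ◁[c] One x) ≡
  slide (place t c x) b y ∘ (slide t c x ◁[b] One y) ∘ Theta t b y c x.
Proof.
move=> tt ty_ tx bt ct ne_bc.
have [lt_bc|lt_cb|/key_inj eq_bc] := ltngtP (key b) (key c).
- have [e E] := slide_theta_lt tt ty_ tx bt ct lt_bc.
  split=> //; have ne_cb : c != b by rewrite eq_sym.
  have [_ _ _ K] := inverse_theta tt tx ty_ bt ct ne_bc.
  have Ts := is_arrow_slide tt ty_ bt; have [_ tp ep] := is_arrow_arity Ts.
  have cp : c \in arity (place t b y) by rewrite -ep; ty.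
  have Ts2 := is_arrow_slide tp tx cp.
  have T : is_arrow (slide (place t b y) c x ∘ (slide t b y ◁[c] One x))
    (t ◁[b] y ◁[c] x) (place (place t b y) c x) by ty.
  by rewrite E (comp_tail K) (comp1 T).
- have [e E] := slide_theta_lt tt tx ty_ ct bt lt_cb.
  by split.
by rewrite eq_bc eqxx in ne_bc.
Qed.

(** * Normalization *)

Fixpoint graft t a f : preterm G :=
  match f with
  | Gen _ => place t a f
  | Unit => t
  | Ins g b k => graft (graft t a g) (a ++ b) k
  end.

Fixpoint merge t a f : prearrow G :=
  match f with
  | Gen _ => slide t a f
  | Unit => Mu t a
  | Ins g b k =>
      merge (graft t a g) (a ++ b) k ∘ (merge t a g ◁[a ++ b] One k)
        ∘ BetaV t a g b k
  end.

Lemma is_arrow_merge t a f : is_term t -> is_term f -> a \in arity t ->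
  is_arrow (merge t a f) (t ◁[a] f) (graft t a f).
Proof.
elim: f t a => [x|| g IHg b k IHk] t a tt tf at_.
- exact: is_arrow_slide.
- by rewrite /=; ty.
rewrite is_term_insE in tf; case/and3P: tf => tg tk bg.
have Tg := IHg t a tt tg at_; have [_ tgr egr] := is_arrow_arity Tg.
have mem : a ++ b \in arity (graft t a g) by rewrite -egr; ty.
by have Tk := IHk _ _ tgr tk mem; rewrite /=; ty.
Qed.

Lemma is_term_graft t a f : is_term t -> is_term f -> a \in arity t ->
  is_term (graft t a f).
Proof. by move=> tt tf at_; have [] := is_arrow_arity (is_arrow_merge tt tf at_). Qed.

Lemma mem_graft t a f c : is_term t -> is_term f -> a \in arity t ->
  c \in arity (t ◁[a] f) -> c \in arity (graft t a f).
Proof.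
by move=> tt tf at_; have [_ _ ->] := is_arrow_arity (is_arrow_merge tt tf at_).
Qed.

#[local] Hint Resolve is_arrow_merge is_term_graft mem_graft : wo.

(** The two orders of merging are to be compared for all contexts t at once,
    since splitting g or f changes the context of its second part. *)
Definition theta_compatible g f := forall t b c, is_term t ->
  b \in arity t -> c \in arity t -> b != c ->
  graft (graft t b g) c f = graft (graft t c f) b g /\
  merge (graft t b g) c f ∘ (merge t b g ◁[c] One f) ≡
  merge (graft t c f) b g ∘ (merge t c f ◁[b] One g) ∘ Theta t b g c f.

Lemma theta_compatible_sym g f : is_term g -> is_term f ->
  theta_compatible g f -> theta_compatible f g.
Proof.
move=> tg tf C t c b tt ct bt ne_cb; have ne_bc : b != c by rewrite eq_sym.
have [e E] := C t b c tt bt ct ne_bc; split=> //.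
have [_ _ _ K] := inverse_theta tt tg tf ct bt ne_cb.
have T : is_arrow (merge (graft t c f) b g ∘ (merge t c f ◁[b] One g))
  (t ◁[c] f ◁[b] g) (graft (graft t c f) b g) by ty.
by rewrite E (comp_tail K) (comp1 T).
Qed.

Lemma theta_compatible_unit f : is_term f -> theta_compatible Unit f.
Proof.
move=> tf t b c tt bt ct ne_bc; have ne_cb : c != b by rewrite eq_sym.
split=> //=; rewrite -theta_unit // compA.
have T := is_arrow_merge tt tf ct.
by rewrite (mu_nat T) //; ty.
Qed.

(** Moving f past g1 ◁_d g2 amounts to moving it past g2 and then past g1, by
    the axiom on θ at an insertion. *)
Lemma theta_compatible_ins g1 d g2 f :
  is_term (g1 ◁[d] g2) -> is_term f ->
  theta_compatible g1 f -> theta_compatible g2 f ->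
  theta_compatible (g1 ◁[d] g2) f.
Proof.
rewrite is_term_insE => /and3P[tg1 tg2 dg1] tf C1 C2.
move=> t b c tt bt ct ne_bc; have ne_cb : c != b by rewrite eq_sym.
have ne_bdc := cat_neq d tt bt ct ne_bc.
have [e1 E1] := C1 t b c tt bt ct ne_bc.
have t1 : is_term (graft t b g1) by ty.
have bd1 : b ++ d \in arity (graft t b g1) by ty.
have c1 : c \in arity (graft t b g1) by ty.
have [e2 E2] := C2 _ _ _ t1 bd1 c1 ne_bdc.
split; rewrite /=; first by rewrite e2 e1.
have T1 := is_arrow_merge tt tg1 bt.
have Tf := is_arrow_merge tt tf ct.
have one1 : is_arrow (One g1) g1 g1 by ty.
have one2 : is_arrow (One g2) g2 g2 by ty.
have onef : is_arrow (One f) f f by ty.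
rewrite !ins_compl !compA E2 e1.
have mem1 : b ++ d \in arity (t ◁[b] g1) by ty.
have mem2 : c \in arity (t ◁[b] g1) by ty.
have ne_cbd : c != b ++ d by rewrite eq_sym.
rewrite (comp_tail (theta_nat onef one2 T1 mem1 mem2 ne_cbd)) !compA.
rewrite -(compA (merge _ _ g2)) -ins_compl E1 !ins_compl !compA.
have mem3 : b \in arity (t ◁[c] f) by ty.
rewrite -ins1 (comp_tail (betaV_nat one2 one1 Tf mem3 dg1)) compA.
by rewrite (comp_tail (betaV_theta_outer _ _ _ _ _ _ _ _)) // !compA.
Qed.

Lemma theta_compatible_all g f : is_term g -> is_term f ->
  theta_compatible g f.
Proof.
elim: g f => [x|| g1 IH1 d g2 IH2] f tg tf.
- elim: f tf => [y|| f1 IH1 d f2 IH2] tf.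
  + by move=> t b c tt bt ct ne_bc; apply: slide_theta.
  + by apply: theta_compatible_sym => //; apply: theta_compatible_unit.
  apply: theta_compatible_sym => //; have := tf; rewrite is_term_insE.
  by case/and3P=> t1 t2 _; apply: theta_compatible_ins => //;
    apply: theta_compatible_sym; auto.
- exact: theta_compatible_unit.
have := tg; rewrite is_term_insE => /and3P[t1 t2 _].
by apply: theta_compatible_ins; auto.
Qed.

(** The two grafts are required to be equal, not isomorphic: this is what makes
    the second equation well typed and the normal form an invariant. *)
Definition merge_natural u f f' := forall t a, is_term t -> a \in arity t ->
  graft t a f' = graft t a f /\
  merge t a f' ∘ (One t ◁[a] u) ≡ merge t a f.

(** This covers β⁻¹, μ⁻¹ and λ⁻¹ once β, μ and λ are known. *)
Lemma merge_natural_inverse f f' u u' : inverse f f' u u' ->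
  merge_natural u f f' -> merge_natural u' f' f.
Proof.
move=> [uT uT' _ K] N t a tt at_; have [e E] := N t a tt at_; split=> //.
have [tf tf' _] := is_arrow_arity uT.
have T := is_arrow_merge tt tf' at_.
by rewrite -E -compA -ins_compr K ins1 (comp1 T).
Qed.

Lemma merge_natural_comp f g h u v : merge_natural u f g ->
  merge_natural v g h -> merge_natural (v ∘ u) f h.
Proof.
move=> Nu Nv t a tt at_; have [e E] := Nu t a tt at_.
have [e' E'] := Nv t a tt at_; split; first by rewrite e'.
by rewrite ins_compr compA E' E.
Qed.

Lemma merge_natural_ins f f' g g' u v b : is_arrow u f f' -> is_arrow v g g' ->
  b \in arity g -> merge_natural u f f' -> merge_natural v g g' ->
  merge_natural (v ◁[b] u) (g ◁[b] f) (g' ◁[b] f').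
Proof.
move=> uT vT bg Nu Nv t a tt at_.
have [tf tf' _] := is_arrow_arity uT; have [tg tg' eg] := is_arrow_arity vT.
have [e E] := Nv t a tt at_.
have tgr : is_term (graft t a g) by ty.
have mem : a ++ b \in arity (graft t a g) by ty.
have [e' E'] := Nu _ _ tgr mem.
split; rewrite /=; first by rewrite e e'.
have onet : is_arrow (One t) t t by ty.
rewrite (comp_tail (betaV_nat uT vT onet at_ bg)) !compA.
rewrite -(compA (merge _ _ f')) -ins_comp E.
have T := is_arrow_merge tt tg at_.
rewrite (comp1l uT) (@ins_split_r _ _ _ _ _ _ _ T uT) compA e E'.
by [].
Qed.

Lemma merge_natural_beta h b g a f : is_term h -> is_term g -> is_term f ->
  b \in arity h -> a \in arity g ->
  merge_natural (Beta h b g a f)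
    (h ◁[b] g ◁[b ++ a] f) (h ◁[b] (g ◁[a] f)).
Proof.
move=> th tg tf bh ag t c tt ct.
have P := pentagonV tt th tg tf ct bh ag.
rewrite /= !catA in P *; split=> //.
have T := is_arrow_merge tt th ct.
have oneg : is_arrow (One g) g g by ty.
have onef : is_arrow (One f) f f by ty.
have mem : c ++ b \in arity (t ◁[c] h) by ty.
rewrite -(@ins1 g) (comp_tail (betaV_nat onef oneg T mem ag)) !compA.
by rewrite (comp_tail3 P) !ins_compl !compA.
Qed.

Lemma merge_natural_theta h b g a f : is_term h -> is_term g -> is_term f ->
  a \in arity h -> b \in arity h -> a != b ->
  merge_natural (Theta h b g a f) (h ◁[b] g ◁[a] f) (h ◁[a] f ◁[b] g).
Proof.
move=> th tg tf ah bh ab t c tt ct.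
have t1 : is_term (graft t c h) by ty.
have ca : c ++ a \in arity (graft t c h) by ty.
have cb : c ++ b \in arity (graft t c h) by ty.
have ba : b != a by rewrite eq_sym.
have ncab := cat_neq2l c ab; have ncba := cat_neq2l c ba.
have [e E] := theta_compatible_all tg tf t1 cb ca ncba.
split; rewrite /= ?e //.
have T := is_arrow_merge tt th ct.
have oneg : is_arrow (One g) g g by ty.
have onef : is_arrow (One f) f f by ty.
have mb : c ++ b \in arity (t ◁[c] h) by ty.
have ma : c ++ a \in arity (t ◁[c] h) by ty.
rewrite !ins_compl !compA.
rewrite (comp_tail3 (betaV_theta_inner tt th tg tf ct bh ah ab)) !compA.
rewrite -(compA _ _ (Theta (t ◁[c] h) _ _ _ _)).
rewrite -(theta_nat onef oneg T mb ma ncab) !compA.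
by rewrite E.
Qed.

Lemma merge_natural_mu f b : is_term f -> b \in arity f ->
  merge_natural (Mu f b) (f ◁[b] Unit) f.
Proof.
move=> tf bf t a tt at_; split=> //=.
have T := is_arrow_merge tt tf at_.
have mem : a ++ b \in arity (t ◁[a] f) by ty.
rewrite (mu_nat T mem) -mu_beta //.
have [_ _ _ K] := inverse_beta tt tf (isT : is_term Unit) at_ bf.
have T' : is_arrow (merge t a f ∘ (One t ◁[a] Mu f b))
  (t ◁[a] (f ◁[b] Unit)) (graft t a f) by ty.
by rewrite compA (comp_tail K) (comp1 T').
Qed.

Lemma merge_natural_lambda f : is_term f ->
  merge_natural (Lambda f) (Unit ◁[[::]] f) f.
Proof.
move=> tf t a tt at_; have U : is_term Unit by [].
have I := inverse_beta tt U tf at_ (isT : [::] \in arity Unit).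
have L := triangle tt tf at_.
rewrite /= cats0 in I *; split=> //.
have [_ _ _ K] := I.
have T' : is_arrow (merge t a f ∘ (One t ◁[a] Lambda f))
  (t ◁[a] (Unit ◁[[::]] f)) (graft t a f) by ty.
by rewrite -L compA (comp_tail K) (comp1 T').
Qed.

Lemma merge_naturality u f f' : is_arrow u f f' -> merge_natural u f f'.
Proof.
elim=> {u f f'}.
- move=> f tf t a tt at_; split=> //.
  have T := is_arrow_merge tt tf at_.
  by rewrite ins1 (comp1 T).
- by move=> *; apply: merge_natural_beta.
- move=> *; apply: merge_natural_inverse (merge_natural_beta _ _ _ _ _) => //.
  exact: inverse_beta.
- by move=> *; apply: merge_natural_theta.
- by move=> *; apply: merge_natural_mu.
- move=> *; apply: merge_natural_inverse (merge_natural_mu _ _) => //.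
  exact: inverse_mu.
- by move=> *; apply: merge_natural_lambda.
- move=> *; apply: merge_natural_inverse (merge_natural_lambda _) => //.
  exact: inverse_lambda.
- by move=> f g h u v _ Nu _; apply: merge_natural_comp.
move=> f f' g g' a u v uT Nu vT Nv /and3P[_ _ ag] _.
exact: merge_natural_ins.
Qed.

(** The context I at position e loses no information, since λ is invertible and
    natural. *)
Lemma is_arrow_eqv f g u v : is_arrow u f g -> is_arrow v f g -> u ≡ v.
Proof.
move=> uT vT; have [tf tg _] := is_arrow_arity uT.
have U : is_term Unit by [].
have e0 : [::] \in arity Unit by [].
have [e Eu] := merge_naturality uT U e0.
have [_ Ev] := merge_naturality vT U e0.
have oneU : is_arrow (One Unit) Unit Unit by ty.
have [Tu Tv] : is_arrow (One Unit ◁[[::]] u) (Unit ◁[[::]] f) (Unit ◁[[::]] g) /\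
  is_arrow (One Unit ◁[[::]] v) (Unit ◁[[::]] f) (Unit ◁[[::]] g).
  by split; ty.
have T := is_arrow_merge U tg e0.
have E := comp_injl T Tu Tv (eqv_trans Eu (eqv_sym Ev)).
apply: (comp_injr (w := Lambda f) _ uT vT); first by ty.
by rewrite -(lambda_nat uT) -(lambda_nat vT) E.
Qed.

End Coherence.

Theorem mainTheorem1 (G : Type) (alpha : G -> nat) : is_preorder (WOe alpha).
Proof.
move=> f g [A hA] [B hB]; apply: arrow_inj => /=.
case: hA hB => u uT -> [v vT ->]; apply: class_eq.
by apply: (is_arrow_eqv uT vT); left.
Qed.
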